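(* Let $G$ be a finite, simple, undirected graph whose vertex set is partitioned into two sets $A$ and $B$. Suppose the edge set of $G$ consists of exactly $m_A$ edges with both endpoints in $A$ and $m_{A,B}$ edges with one endpoint in $A$ and one endpoint in $B$ (so there are no edges with both endpoints in $B$). Then the largest eigenvalue $\lambda(G)$ of the adjacency matrix of $G$ satisfies $$\lambda(G)\leq \sqrt{m_A+m_{A,B}+\sqrt{m_A^2+2m_Am_{A,B}}}.$$ *)

(* Defs.v *)
From HB Require Import structures.
From mathcomp Require Import all_boot all_order all_algebra.

Set Implicit Arguments.
Unset Strict Implicit.
Unset Printing Implicit Defensive.

Import Order.TTheory GRing.Theory Num.Theory.
Local Open Scope ring_scope.

(* A finite simple undirected graph is a finType T of vertices together with a
   symmetric irreflexive adjacency relation e. *)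

(* Edges are unordered pairs [set x; y], so each edge is counted once even when
   X and Y overlap; edges_between e X X is the set of edges with both endpoints
   in X. *)
Definition edges_between (T : finType) (e : rel T) (X Y : {set T}) :
    {set {set T}} :=
  [set [set x; y] | x in X, y in Y & e x y].

Definition adjacency_mx (R : nzRingType) (T : finType) (e : rel T) :
    'M[R]_#|T| :=
  \matrix_(i, j) (e (enum_val i) (enum_val j))%:R.

Definition is_largest_eigenvalue (R : numFieldType) (n : nat) (M : 'M[R]_n)
    (l : R) : Prop :=
  eigenvalue M l /\ forall a : R, eigenvalue M a -> a <= l.

(* Main.v *)
Require Import Defs.
From HB Require Import structures.
From mathcomp Require Import all_boot all_order all_algebra.
From mathcomp Require Import ring lra.

(** Let [x] be an eigenvector for [lambda > 0], and let [M] and [N] be the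
    [A]-[A] and [A]-[B] blocks of the adjacency matrix.  As there are no edges
    inside [B], eliminating [x_B] from the eigenvalue equations gives
    [lambda^2 x_A = lambda M x_A + N N^T x_A] with [x_A <> 0].  Bounding both
    operator norms by Frobenius norms, [|M|^2 <= 2 mA] and [|N|^2 <= mAB], so
    [lambda^2 <= lambda sqrt (2 mA) + mAB], and solving this quadratic
    inequality for [lambda^2] yields the bound. *)

Set Implicit Arguments.
Unset Strict Implicit.
Unset Printing Implicit Defensive.

Import Order.TTheory GRing.Theory Num.Theory.
Local Open Scope ring_scope.

Lemma sum_cauchy_schwarz (R : realFieldType) (I : finType) (P : pred I)
    (a b : I -> R) :
  (\sum_(i | P i) a i * b i) ^+ 2 <=
  (\sum_(i | P i) a i ^+ 2) * (\sum_(i | P i) b i ^+ 2).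
Proof.
(* Lagrange's identity. *)
have : 0 <= \sum_(i | P i) \sum_(j | P j) (a i * b j - a j * b i) ^+ 2.
  by apply: sumr_ge0 => i _; apply: sumr_ge0 => j _; apply: sqr_ge0.
suff -> : \sum_(i | P i) \sum_(j | P j) (a i * b j - a j * b i) ^+ 2 =
  2 * ((\sum_(i | P i) a i ^+ 2) * (\sum_(i | P i) b i ^+ 2)
       - (\sum_(i | P i) a i * b i) ^+ 2) by lra.
pose F i j := a i ^+ 2 * b j ^+ 2.
transitivity (\sum_(i | P i) \sum_(j | P j) F i j
              + \sum_(i | P i) \sum_(j | P j) F j i
              - 2 * \sum_(i | P i) \sum_(j | P j) (a i * b i) * (a j * b j)).
  rewrite mulr_sumr -big_split -sumrB; apply: eq_bigr => i _ /=.
  rewrite mulr_sumr -big_split -sumrB; apply: eq_bigr => j _ /=.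
  by rewrite /F; ring.
rewrite [X in _ + X - _]exchange_big /= -!big_distrlr /=; ring.
Qed.

Lemma arc_sumE (R : nzRingType) (T : finType) (e : rel T) (X Y : {set T}) :
  \sum_(x in X) \sum_(y in Y) (e x y)%:R =
  #|[set p : T * T | [&& p.1 \in X, p.2 \in Y & e p.1 p.2]]|%:R :> R.
Proof.
rewrite pair_big -sum1_card natr_sum /=.
rewrite [RHS](eq_bigl (fun p : T * T => ((p.1 \in X) && (p.2 \in Y)) && e p.1 p.2)).
  by rewrite [RHS]big_mkcondr; apply: eq_bigr => p _; case: (e _ _).
by move=> p; rewrite inE andbA.
Qed.

Lemma edges_betweenE (T : finType) (e : rel T) (X Y : {set T}) :
  edges_between e X Y =
  [set [set p.1; p.2] |
     p in [set p : T * T | [&& p.1 \in X, p.2 \in Y & e p.1 p.2]]].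
Proof.
apply/setP => s; apply/imset2P/imsetP => [[x y xX]|[[x y]]].
  rewrite inE => /andP[yY exy] ->.
  by exists (x, y) => //; rewrite inE /= xX yY exy.
rewrite inE /= => /and3P[xX yY exy] ->.
by exists x y; rewrite // inE yY exy.
Qed.

Lemma set2_eqP (T : finType) (a b x y : T) :
  [set x; y] = [set a; b] -> (x, y) = (a, b) \/ (x, y) = (b, a).
Proof.
move=> E.
have /set2P xab : x \in [set a; b] by rewrite -E set21.
have /set2P yab : y \in [set a; b] by rewrite -E set22.
have /set2P axy : a \in [set x; y] by rewrite E set21.
have /set2P bxy : b \in [set x; y] by rewrite E set22.
(* When [x] and [y] are the same element, [a] and [b] both lie in a singleton, so all four
   coincide. *)
case: xab yab axy bxy => -> [] ->; [| by left | by right |].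
  by move=> _ [] ->; left.
by move=> [] -> _; left.
Qed.

(** The fibre of [(x, y) |-> [set x; y]] over an edge [[set a; b]] lies in
    [[set (a, b); (b, a)]]. *)
Lemma card_arcs_le (T : finType) (e : rel T) (X Y : {set T}) :
  (#|[set p : T * T | [&& p.1 \in X, p.2 \in Y & e p.1 p.2]]|
     <= 2 * #|edges_between e X Y|)%N.
Proof.
rewrite edges_betweenE; set D := [set p | _].
pose h (p : T * T) := [set p.1; p.2].
rewrite -[X in (X <= _)%N]sum1_card (partition_big_imset h) /=.
rewrite mulnC -sum_nat_const; apply: leq_sum => _ /imsetP[[a b] _ ->].
rewrite sum1_card; apply: (@leq_trans #|[set (a, b); (b, a)]|); last first.
  by rewrite cards2; case: (_ != _).
apply/subset_leq_card/subsetP => -[x y] /andP[_ /eqP /set2_eqP xy].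
by apply/set2P.
Qed.

(** Here the map from arcs to edges is injective: reversing an arc would place an element of [X] in
    [Y]. *)
Lemma card_arcs_disjoint (T : finType) (e : rel T) (X Y : {set T}) :
  [disjoint X & Y] ->
  #|[set p : T * T | [&& p.1 \in X, p.2 \in Y & e p.1 p.2]]|
    = #|edges_between e X Y|.
Proof.
move=> dXY; rewrite edges_betweenE card_in_imset //.
move=> [x y] [a b]; rewrite !inE /= => /and3P[xX _ _] /and3P[_ bY _].
case/set2_eqP => // -[xb _].
by move: (disjointFr dXY xX); rewrite xb bY.
Qed.

(** Cauchy-Schwarz over ordered pairs: 0/1 entries are their own squares, each edge gives at most
    two arcs, and the sum of the [(f x * f y) ^+ 2] factors. *)
Lemma quadratic_form_bound (R : realFieldType) (T : finType) (e : rel T)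
    (X : {set T}) (f : T -> R) :
  (\sum_(x in X) \sum_(y in X) f x * f y * (e x y)%:R) ^+ 2 <=
  2 * #|edges_between e X X|%:R * (\sum_(x in X) f x ^+ 2) ^+ 2.
Proof.
rewrite pair_big /=; apply: le_trans (sum_cauchy_schwarz _ _ _) _.
rewrite mulrC; apply: ler_pM.
- by apply: sumr_ge0 => p _; apply: sqr_ge0.
- by apply: sumr_ge0 => p _; apply: sqr_ge0.
- rewrite -natrM; apply: le_trans (_ : _ <= _%:R) _; last first.
    by rewrite ler_nat; apply: card_arcs_le.
  rewrite -arc_sumE pair_big le_eqVlt; apply/orP; left; apply/eqP.
  by apply: eq_bigr => p _ /=; case: (e _ _); rewrite ?expr1n ?expr0n.
- rewrite expr2 big_distrlr pair_big le_eqVlt; apply/orP; left; apply/eqP.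
  by apply: eq_bigr => p _ /=; rewrite exprMn.
Qed.

(** Cauchy-Schwarz is applied for each [y] separately; summing the degrees into [X] then counts each
    edge once. *)
Lemma bipartite_form_bound (R : realFieldType) (T : finType) (e : rel T)
    (X Y : {set T}) (f : T -> R) :
  [disjoint X & Y] ->
  \sum_(y in Y) (\sum_(x in X) f x * (e x y)%:R) ^+ 2 <=
  #|edges_between e X Y|%:R * \sum_(x in X) f x ^+ 2.
Proof.
move=> dXY; rewrite -card_arcs_disjoint // -arc_sumE exchange_big mulr_suml /=.
apply: ler_sum => y _; apply: le_trans (sum_cauchy_schwarz _ _ _) _.
rewrite mulrC le_eqVlt; apply/orP; left; apply/eqP; congr (_ * _).
by apply: eq_bigr => x _; case: (e _ _); rewrite ?expr1n ?expr0n.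
Qed.

(** Passes from row eigenvectors indexed by ordinals to functions on vertices; the row convention is
    why the sum runs over the first argument of [e]. *)
Lemma adjacency_eigenvalueP (R : fieldType) (T : finType) (e : rel T) (l : R) :
  eigenvalue (adjacency_mx R e) l ->
  exists2 f : T -> R, forall y, \sum_x f x * (e x y)%:R = l * f y
                    & exists x, f x != 0.
Proof.
case/eigenvalueP => v vM v0; exists (fun x => v 0 (enum_rank x)).
  move=> y; have /matrixP/(_ 0 (enum_rank y)) := vM; rewrite !mxE => <-.
  rewrite (reindex enum_rank) /=; last exact: onW_bij (@enum_rank_bij T).
  by apply: eq_bigr => x _; rewrite !mxE !enum_rankK.
by case/rV0Pn: v0 => i vi; exists (enum_val i); rewrite enum_valK.
Qed.

Lemma sqr_root_bound (R : rcfType) (l p a b : R) :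
  0 < l -> 0 <= a -> 0 <= b -> p ^+ 2 <= 2 * a -> l ^+ 2 <= l * p + b ->
  l <= Num.sqrt (a + b + Num.sqrt (a ^+ 2 + 2 * a * b)).
Proof.
move=> l0 a0 b0 pa lpb.
rewrite -(ger0_norm (ltW l0)) -sqrtr_sqr ler_wsqrtr // -lerBlDl.
(* Squaring [l ^+ 2 - b <= l * p] needs a nonnegative left side; otherwise [l ^+ 2 - (a + b)] is
   already nonpositive. *)
have [lb|bl] := leP (l ^+ 2) b.
  by apply: le_trans (sqrtr_ge0 _); lra.
apply: le_trans (ler_norm _) _; rewrite -sqrtr_sqr ler_wsqrtr //.
have : (l ^+ 2 - b) ^+ 2 <= l ^+ 2 * (2 * a).
  apply: (@le_trans _ _ ((l * p) ^+ 2)).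
    by rewrite ler_sqr ?nnegrE; lra.
  by rewrite exprMn ler_wpM2l ?sqr_ge0.
(* Completing the square: [(s - b) ^+ 2 <= 2 * a * s] is equivalent to
   [(s - (a + b)) ^+ 2 <= a ^+ 2 + 2 * a * b]. *)
by move: (l ^+ 2) => s; nra.
Qed.

Theorem theorem2 (R : rcfType) (T : finType) (e : rel T)
    (e_sym : symmetric e) (e_irr : irreflexive e)
    (A B : {set T}) (AB_cover : A :|: B = [set: T]) (AB_disj : [disjoint A & B])
    (mA mAB : nat)
    (card_A : #|edges_between e A A| = mA)
    (card_AB : #|edges_between e A B| = mAB)
    (no_B : edges_between e B B = set0)
    (lambda : R) (lambda_max : is_largest_eigenvalue (adjacency_mx R e) lambda) :
  lambda <= Num.sqrt (mA%:R + mAB%:R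
                      + Num.sqrt (mA%:R ^+ 2 + 2 * mA%:R * mAB%:R)).
Proof.
case: lambda_max => /adjacency_eigenvalueP[f fE [x0 fx0]] _.
have [l0|l_gt0] := leP lambda 0; first exact: le_trans l0 (sqrtr_ge0 _).
have sumAB (F : T -> R) : \sum_x F x = \sum_(x in A) F x + \sum_(x in B) F x.
  rewrite -bigU //=; apply: eq_bigl => x.
  by have := in_setT x; rewrite -AB_cover !inE.
have eBB x y : x \in B -> y \in B -> e x y = false.
  move=> xB yB; apply: contraFF (in_set0 [set x; y]) => exy.
  by rewrite -no_B; apply/imset2P; exists x y; rewrite ?inE ?yB.
have fB y : y \in B -> lambda * f y = \sum_(x in A) f x * (e x y)%:R.
  move=> yB; rewrite -fE sumAB [X in _ + X]big1 ?addr0 // => x xB.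
  by rewrite eBB // mulr0.
pose S := \sum_(x in A) f x ^+ 2.
pose P := \sum_(x in A) \sum_(y in A) f x * f y * (e x y)%:R.
(* If [f] vanished on [A], then [fB] and [lambda > 0] would make it vanish on [B] too. *)
have S_gt0 : 0 < S.
  have S_ge0 : 0 <= S by apply: sumr_ge0 => x _; apply: sqr_ge0.
  rewrite lt_neqAle S_ge0 andbT eq_sym; apply: contraNneq fx0 => S0.
  have fA x : x \in A -> f x = 0.
    move=> xA; apply/eqP; rewrite -sqrf_eq0; apply/eqP.
    by apply: (psumr_eq0P _ S0) => // z _; apply: sqr_ge0.
  have : x0 \in A :|: B by rewrite AB_cover inE.
  case/setUP => [/fA ->//|/fB].
  rewrite big1 => [/eqP|x /fA ->]; last by rewrite mul0r.
  by rewrite mulf_eq0 gt_eqF.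
(* Pair the eigenvalue equation on [A] with [lambda * f]; in the cross term, [fB] turns each
   [lambda * f y] with [y] in [B] into a sum over [A]. *)
have lS : lambda ^+ 2 * S =
    lambda * P + \sum_(y in B) (\sum_(x in A) f x * (e x y)%:R) ^+ 2.
  have -> : \sum_(y in B) (\sum_(x in A) f x * (e x y)%:R) ^+ 2
          = lambda * \sum_(x in A) \sum_(y in B) f x * f y * (e x y)%:R.
    rewrite exchange_big mulr_sumr; apply: eq_bigr => y yB /=.
    rewrite expr2 -{1}fB // -mulrA mulr_sumr; congr (_ * _).
    by apply: eq_bigr => x _; rewrite mulrCA mulrA.
  rewrite -mulrDr expr2 -mulrA -big_split mulr_sumr; congr (_ * _).
  apply: eq_bigr => x _ /=; rewrite -sumAB expr2 mulrA -fE mulr_suml.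
  by apply: eq_bigr => y _; rewrite e_sym; ring.
have PS := quadratic_form_bound e A f.
have QS := bipartite_form_bound e f AB_disj.
rewrite -/P -/S card_A in PS; rewrite -/S card_AB in QS.
(* [P / S] is the Rayleigh quotient of the [A]-[A] block at the restriction of [f] to [A]. *)
apply: (@sqr_root_bound _ _ (P / S)) => //.
  by rewrite exprMn exprVn ler_pdivrMr // exprn_gt0.
by rewrite -(ler_pM2r S_gt0) lS mulrDl mulrA divfK ?gt_eqF // lerD2l.
Qed.
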